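(* Let $(X_t)_{t\in\mathbb Z}$ be a stationary reversible Markov chain on a state space $(E,\mathcal E)$, with invariant law $\nu$ and transition kernel $K$. Assume that $I-K^2$ is invertible on $L^2_0(\nu)$, and let $f\in\mathcal H_2$. Then there exist unique functions $a,b\in L^2_0(\nu)$ and a unique function $g\in\mathcal I_2$ such that $$f(x,y)=g(x,y)+a(x)+b(y).$$ Moreover, $g(x,y)$ and $a(x)+b(y)$ are orthogonal in $\mathcal H_2$.
   Context: The kernel $K$ acts on $L^2(\nu)$ by $(Kh)(x)=\int_E h(y)\,K(x,dy)$ and maps $L^2_0(\nu)=\{h\in L^2(\nu):\int h\,d\nu=0\}$ into itself; reversibility means $K$ is self-adjoint on $L^2(\nu)$. Let $\pi_2(dx,dy)=\nu(dx)K(x,dy)$ be the law of $(X_1,X_2)$, and $\mathcal H_2=L^2_0(\pi_2)$ the Hilbert space of real-valued $f\in L^2(\pi_2)$ with $\int f\,d\pi_2=0$; equalities between elements of $\mathcal H_2$ are $\pi_2$-almost everywhere. Let $W_1^L=\{u(x):u\in L^2_0(\nu)\}$ and $W_1^R=\{v(y):v\in L^2_0(\nu)\}$, viewed as subspaces of $\mathcal H_2$ (functions of the first, respectively second, coordinate). The incremental space is $\mathcal I_2=(W_1^L+W_1^R)^\perp$, the orthogonal complement in $\mathcal H_2$; equivalently, $g\in\mathcal I_2$ iff $E(g(X_1,X_2)\mid X_1)=0$ and $E(g(X_1,X_2)\mid X_2)=0$. *)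

(* Defs.v *)
From HB Require Import structures.
From mathcomp Require Import all_boot all_order all_algebra.
From mathcomp Require Import all_classical all_reals all_analysis measurable_realfun.

Set Implicit Arguments.
Unset Strict Implicit.
Unset Printing Implicit Defensive.
Import Order.TTheory GRing.Theory Num.Theory.
Import numFieldNormedType.Exports.
Local Open Scope classical_set_scope.
Local Open Scope ring_scope.

(* Elements of L^2 are represented by functions T -> R belonging to
   [Lfun mu 2]; equality of elements of L^2 is [f = g %[ae mu]]. *)
Section L2.
Context d (T : measurableType d) (R : realType) (mu : {measure set T -> \bar R}).

Definition L20 : set (T -> R) :=
  [set f | f \in Lfun mu 2%:E /\ \int[mu]_x f x = 0].

Definition L2_inner (f g : T -> R) : R := \int[mu]_x (f x * g x).

Definition L2_orthogonal (f g : T -> R) : Prop := L2_inner f g = 0.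

Definition L20_orthogonal_complement (W : set (T -> R)) : set (T -> R) :=
  [set g | L20 g /\ forall w, W w -> L2_orthogonal g w].

(* The second condition says that S is well defined on classes modulo
   mu-almost everywhere equality. *)
Definition L20_bounded_operator (S : (T -> R) -> (T -> R)) : Prop :=
  [/\ forall h, L20 h -> L20 (S h),
      forall h k, L20 h -> L20 k -> h = k %[ae mu] -> S h = S k %[ae mu],
      forall (c : R) h k, L20 h -> L20 k ->
        S (c \*: h \+ k) = (c \*: S h \+ S k) %[ae mu]
    & exists C : R, forall h, L20 h ->
        ('N[mu]_2%:E[EFin \o S h] <= C%:E * 'N[mu]_2%:E[EFin \o h])%E].

Definition L20_invertible (A : (T -> R) -> (T -> R)) : Prop :=
  exists S, [/\ L20_bounded_operator S,
                forall h, L20 h -> S (A h) = h %[ae mu]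
              & forall h, L20 h -> A (S h) = h %[ae mu]].

End L2.

Section kernel_operator.
Context d (E : measurableType d) (R : realType).

(* For h in L^2(nu), nu invariant, h is integrable for K x for nu-almost every
   x; elsewhere the integral takes a default value. *)
Definition kernel_op (K : R.-pker E ~> E) (h : E -> R) : E -> R :=
  fun x => \int[K x]_y h y.

Definition self_adjoint_kernel (nu : probability E R) (K : R.-pker E ~> E) :=
  forall h k, h \in Lfun nu 2%:E -> k \in Lfun nu 2%:E ->
    L2_inner nu (kernel_op K h) k = L2_inner nu h (kernel_op K k).

Definition id_sub_kernel_sqr (K : R.-pker E ~> E) (h : E -> R) : E -> R :=
  h \- kernel_op K (kernel_op K h).

End kernel_operator.

Section chain.
Context d0 (Omega : measurableType d0) d (E : measurableType d) (R : realType)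
  (P : probability Omega R).

Definition past_sigma_algebra (X : int -> {RV P >-> E}) (t : int) :
    set (set Omega) :=
  <<s \bigcup_(s in [set s : int | s <= t])
        preimage_set_system setT (X s) measurable >>.

Record stationary_reversible_markov_chain (X : int -> {RV P >-> E})
    (nu : probability E R) (K : R.-pker E ~> E) : Prop := {
  chain_stationary : forall (n : nat) (t : 'I_n -> int) (h : int)
      (B : 'I_n -> set E), (forall i, measurable (B i)) ->
    P (\bigcap_i (X (t i + h) @^-1` B i)) = P (\bigcap_i (X (t i) @^-1` B i)) ;
  chain_law : forall (t : int) (B : set E), measurable B ->
    distribution P (X t) B = nu B ;
  chain_markov : forall (t : int) (A : set Omega) (B : set E),
    past_sigma_algebra X t A -> measurable B ->
    P (A `&` X (t + 1) @^-1` B) = (\int[P]_(w in A) K (X t w) B)%E ;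
  chain_reversible : self_adjoint_kernel nu K }.

End chain.

(* The law nu(dx) K(x, dy) of two consecutive states. *)
Section pair_law.
Context d (E : measurableType d) (R : realType)
  (nu : probability E R) (K : R.-pker E ~> E).
Local Open Scope ereal_scope.

Definition pair_law (A : set (E * E)) : \bar R :=
  \int[nu]_x K x (xsection A x).

Let pair_law0 : pair_law set0 = 0.
Proof. by apply: integral0_eq => x _; rewrite xsection0 measure0. Qed.

Let pair_law_ge0 A : 0 <= pair_law A.
Proof. exact: integral_ge0. Qed.

Let measurable_section A : measurable A ->
  measurable_fun setT ((fun x => K x (xsection A x)) : E -> \bar R).
Proof.
move=> mA; rewrite -(kfcompkindic K mA); apply: measurable_kfcomp => //.
  exact/measurable_EFinP.
by move=> t; rewrite lee_fin.
Qed.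

Let pair_law_sigma_additive : semi_sigma_additive pair_law.
Proof.
move=> A mA tA mUA.
have -> : pair_law (\bigcup_n A n) =
    \int[nu]_x \sum_(n <oo) K x (xsection (A n) x).
  apply: eq_integral => x _; rewrite xsection_bigcup measure_bigcup//.
  - by apply: eq_eseriesl => n; rewrite in_setT.
  - by move=> n _; exact: measurable_xsection.
  - exact: trivIset_xsection.
rewrite integral_nneseries//; last by move=> n; exact: measurable_section.
by apply: is_cvg_ereal_nneg_natsum => n _; exact: integral_ge0.
Qed.

HB.instance Definition _ := isMeasure.Build _ _ _ pair_law
  pair_law0 pair_law_ge0 pair_law_sigma_additive.

Let pair_law_setT : pair_law setT = 1.
Proof.
rewrite /pair_law (eq_integral (cst 1)).
  rewrite integral_cst// mul1e; exact: probability_setT.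
move=> x _; rewrite (_ : xsection _ x = setT) ?prob_kernel//.
by apply/seteqP; split => // y _; rewrite xsectionE.
Qed.

HB.instance Definition _ :=
  Measure_isProbability.Build _ _ _ pair_law pair_law_setT.

End pair_law.

Section incremental_space.
Context d (E : measurableType d) (R : realType)
  (nu : probability E R) (K : R.-pker E ~> E).

Definition H2 : set (E * E -> R) := L20 (pair_law nu K).

Definition W1L : set (E * E -> R) := [set u \o fst | u in L20 nu].

Definition W1R : set (E * E -> R) := [set v \o snd | v in L20 nu].

Definition incremental_space : set (E * E -> R) :=
  L20_orthogonal_complement (pair_law nu K)
    [set wl \+ wr | wl in W1L & wr in W1R].

Definition incremental_decomposition (f : E * E -> R) (a b : E -> R)
    (g : E * E -> R) : Prop :=
  [/\ L20 nu a, L20 nu b, incremental_space g &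
      f = (fun z => g z + a z.1 + b z.2) %[ae pair_law nu K]].

End incremental_space.

(* Main.v *)
(** Write [f1 x = E(f | X1 = x)] and [f2 y = E(f | X2 = y)]; by reversibility
    the pair law is symmetric, so both are integrals against [K].  Testing
    against [u(x)] and [v(y)], the residual [f - a - b] is incremental iff
    [a + K b = f1] and [K a + b = f2], i.e. iff [(I - K^2) a = f1 - K f2] and
    [b = f2 - K a].  Invertibility of [I - K^2] gives existence and uniqueness
    of [a], hence of [b] and of the residual. *)

Require Import Defs.
From HB Require Import structures.
From mathcomp Require Import all_boot all_order all_algebra.
From mathcomp Require Import all_classical all_reals all_analysis measurable_realfun.
From mathcomp Require Import lra.

Set Implicit Arguments.
Unset Strict Implicit.

Import Order.TTheory GRing.Theory Num.Theory.
Import numFieldNormedType.Exports.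
Local Open Scope classical_set_scope.
Local Open Scope ring_scope.

(** * Inner products and almost-everywhere equality in L^2 *)

Section L2_theory.
Context d (T : measurableType d) (R : realType) (mu : {measure set T -> \bar R}).
Implicit Types f g h : T -> R.

Lemma Lfun2_measurable f : f \in Lfun mu 2%:E -> measurable_fun setT f.
Proof. by move=> /sub_Lfun_mfun; rewrite inE. Qed.

(** Reduces membership to finiteness of a nonnegative integral, the form to which Tonelli and the
    swap of coordinates apply. *)
Lemma Lfun2P f : f \in Lfun mu 2%:E <->
  measurable_fun setT f /\ (\int[mu]_x (f x ^+ 2)%:E < +oo)%E.
Proof.
split=> [Lf|[mf f2oo]].
  split; first exact: Lfun2_measurable.
  exact: integrable_lty (Lfun2_integrable_sqr Lf).
rewrite inE/=; apply/andP; split; rewrite inE//= /finite_norm unlock /Lnorm.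
rewrite poweR_lty//; under eq_integral => x _ do
  rewrite /= powR_mulrn// real_normK ?num_real//.
by [].
Qed.

Lemma Lfun2D f g : f \in Lfun mu 2%:E -> g \in Lfun mu 2%:E ->
  (f \+ g) \in Lfun mu 2%:E.
Proof. exact: (proj2 (@Lfun_addr_closed _ _ _ mu 2%:E (lee1n 2))). Qed.

Lemma Lfun2N f : f \in Lfun mu 2%:E -> (\- f) \in Lfun mu 2%:E.
Proof. exact: Lfun_oppr_closed. Qed.

Lemma Lfun2B f g : f \in Lfun mu 2%:E -> g \in Lfun mu 2%:E ->
  (f \- g) \in Lfun mu 2%:E.
Proof. by move=> Lf Lg; apply: Lfun2D => //; exact: Lfun2N. Qed.

Lemma Lfun2_integrableM f g : f \in Lfun mu 2%:E -> g \in Lfun mu 2%:E ->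
  mu.-integrable setT (EFin \o (f \* g)).
Proof. by move=> Lf Lg; apply/Lfun1_integrable/Lfun2_mul_Lfun1. Qed.

Lemma L2_innerC f g : L2_inner mu f g = L2_inner mu g f.
Proof. by apply: eq_Rintegral => x _; rewrite mulrC. Qed.

Lemma L2_innerDl f g h : f \in Lfun mu 2%:E -> g \in Lfun mu 2%:E ->
  h \in Lfun mu 2%:E ->
  L2_inner mu (f \+ g) h = L2_inner mu f h + L2_inner mu g h.
Proof.
move=> Lf Lg Lh; rewrite /L2_inner -RintegralD//; [|exact: Lfun2_integrableM..].
by apply: eq_Rintegral => x _; rewrite /= mulrDl.
Qed.

Lemma L2_innerBl f g h : f \in Lfun mu 2%:E -> g \in Lfun mu 2%:E ->
  h \in Lfun mu 2%:E ->
  L2_inner mu (f \- g) h = L2_inner mu f h - L2_inner mu g h.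
Proof.
move=> Lf Lg Lh; rewrite /L2_inner -RintegralB//; [|exact: Lfun2_integrableM..].
by apply: eq_Rintegral => x _; rewrite /= mulrBl.
Qed.

Lemma L2_inner_ae f g h : f \in Lfun mu 2%:E -> g \in Lfun mu 2%:E ->
  h \in Lfun mu 2%:E -> f = g %[ae mu] -> L2_inner mu f h = L2_inner mu g h.
Proof.
move=> Lf Lg Lh fg; congr fine; apply: ae_eq_integral => //.
- by have /measurable_int := Lfun2_integrableM Lf Lh.
- by have /measurable_int := Lfun2_integrableM Lg Lh.
- by apply: filterS fg => x /= fgx _; rewrite fgx.
Qed.

Lemma L2_inner_eq0 h : h \in Lfun mu 2%:E -> L2_inner mu h h = 0 ->
  h = (fun=> 0) %[ae mu].
Proof.
move=> Lh hh0; have ih := Lfun2_integrableM Lh Lh.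
have : (\int[mu]_x `|(h x * h x)%:E| = 0)%E.
  under eq_integral do rewrite gee0_abs ?lee_fin -?expr2 ?sqr_ge0//.
  (* [fine] also sends infinite values to 0, so finiteness of the integral is what recovers the
     extended-real equation. *)
  by rewrite -[LHS]fineK ?integrable_fin_num//; congr EFin.
move=> /(ae_eq_integral_abs mu measurableT (measurable_int mu ih)).1.
apply: filterS => x /(_ I)[/eqP].
by rewrite mulf_eq0 orbb => /eqP.
Qed.

Lemma ae_eq_of_sub f g : f \- g = (fun=> 0) %[ae mu] -> f = g %[ae mu].
Proof. by apply: filterS => x /= /(_ I)/subr0_eq. Qed.

Lemma L2_inner0l h : L2_inner mu (fun=> 0) h = 0.
Proof.
rewrite /L2_inner; under eq_Rintegral do rewrite mul0r.
by rewrite /Rintegral integral0.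
Qed.

(** In this form almost-everywhere equality can be carried along any map that preserves inner
    products. *)
Lemma eq_aeP f g : f \in Lfun mu 2%:E -> g \in Lfun mu 2%:E ->
  f = g %[ae mu] <-> L2_inner mu (f \- g) (f \- g) = 0.
Proof.
move=> Lf Lg; have Lfg := Lfun2B Lf Lg; split=> [fg|/(L2_inner_eq0 Lfg)].
  by rewrite L2_innerBl// (L2_inner_ae Lf Lg Lfg fg) subrr.
exact: ae_eq_of_sub.
Qed.

Hypothesis mu1 : mu setT = 1%E.

Let mu_fin : mu setT \is a fin_num. Proof. by rewrite mu1. Qed.

Lemma Lfun2_cst (c : R) : (fun=> c) \in Lfun mu 2%:E.
Proof.
apply/Lfun2P; split => //.
by rewrite integral_cst// mu1 mule1 ltry.
Qed.

Lemma Lfun2_indic (A : set T) : measurable A -> \1_A \in Lfun mu 2%:E.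
Proof.
move=> mA; apply/Lfun2P; split => //.
under eq_integral => x _ do
  rewrite expr2 -[_ * _]/((\1_A \* \1_A) x) -indicI setIid.
rewrite integral_indic// setIT; apply: le_lt_trans (ltry 1).
by rewrite -mu1 le_measure ?inE.
Qed.

Lemma Lfun2_integrable f : f \in Lfun mu 2%:E -> mu.-integrable setT (EFin \o f).
Proof. by move=> Lf; apply/Lfun1_integrable; apply: (Lfun_subset12 mu_fin). Qed.

(** Jensen's inequality for the square: the variance E(f - m)^2 = E f^2 - m^2 is nonnegative. *)
Lemma sqr_Rintegral_le f : f \in Lfun mu 2%:E ->
  (\int[mu]_x f x) ^+ 2 <= \int[mu]_x f x ^+ 2.
Proof.
move=> Lf; set m := \int[mu]_x f x.
have Lm := Lfun2_cst m.
have mE : L2_inner mu (fun=> m) f = m ^+ 2.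
  by rewrite /L2_inner RintegralZl//; exact: Lfun2_integrable.
have mm : L2_inner mu (fun=> m) (fun=> m) = m ^+ 2.
  by rewrite /L2_inner Rintegral_cst// mu1 /= mulr1.
have : 0 <= L2_inner mu (f \- fun=> m) (f \- fun=> m).
  by apply: Rintegral_ge0 => x _; rewrite -expr2 sqr_ge0.
rewrite L2_innerBl ?Lfun2B// 2!(L2_innerC _ (f \- _)) !L2_innerBl//.
by rewrite mE mm (L2_innerC f) mE subrr subr0 subr_ge0.
Qed.

Lemma L20_Lfun f : L20 mu f -> f \in Lfun mu 2%:E. Proof. by case. Qed.

Lemma L20_cst0 : L20 mu (fun=> 0).
Proof. by split; [exact: Lfun2_cst|rewrite Rintegral_cst// mul0r]. Qed.

Lemma L20B f g : L20 mu f -> L20 mu g -> L20 mu (f \- g).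
Proof.
move=> [Lf f0] [Lg g0]; split; first exact: Lfun2B.
by rewrite RintegralB// ?f0 ?g0 ?subrr//; exact: Lfun2_integrable.
Qed.

(** The single test function f - g suffices. *)
Lemma eq_ae_of_L2_inner f g : f \in Lfun mu 2%:E -> g \in Lfun mu 2%:E ->
  (forall h, h \in Lfun mu 2%:E -> L2_inner mu f h = L2_inner mu g h) ->
  f = g %[ae mu].
Proof.
move=> Lf Lg fg; apply/eq_aeP => //.
by rewrite L2_innerBl ?Lfun2B// fg ?subrr// Lfun2B.
Qed.

End L2_theory.

(** * The kernel sending x to the law of (x, y), with y drawn from [K x] *)

Section graph_kernel.
Context d (E : measurableType d) (R : realType) (K : R.-pker E ~> E).

(* The [pushforward] instance is given by its generated name because it takes
   the measurability proof as an argument that unification cannot find. *)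
Definition graph_kernel (z : unit * E) : {measure set (E * E) -> \bar R} :=
  measure_function_pushforward__canonical__measure_function_Measure
    (K z.2) (pair1_measurable z.2).

Let measurable_graph_kernel U : measurable U ->
  measurable_fun setT (graph_kernel ^~ U).
Proof.
move=> mU.
rewrite (_ : graph_kernel ^~ U = (fun x => K x (xsection U x)) \o snd).
  apply: measurableT_comp => //.
  by apply: (measurable_fun_xsection_finite_kernel K); rewrite inE.
by apply/funext => z /=; rewrite xsectionE.
Qed.

HB.instance Definition _ :=
  isKernel.Build _ _ _ _ _ graph_kernel measurable_graph_kernel.

Let graph_kernel_prob z : graph_kernel z setT = 1%E.
Proof. by rewrite /graph_kernel/= /pushforward preimage_setT prob_kernel. Qed.

HB.instance Definition _ :=
  Kernel_isProbability.Build _ _ _ _ _ graph_kernel graph_kernel_prob.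

End graph_kernel.

(** * Integration against the pair law and conditioning on the first coordinate *)

Section pair_law_theory.
Context d (E : measurableType d) (R : realType)
  (nu : probability E R) (K : R.-pker E ~> E).
Local Notation pi2 := (pair_law nu K).

(** Viewing nu as a kernel from the one-point space makes the pair law a composition [kcomp]; hence
    the factor [unit] in the source of [graph_kernel]. *)
Let nu_kernel : R.-pker unit ~> E :=
  kprobability (measurable_cst (nu : pprobability E R)).

(** Tonelli: the pair law agrees on measurable sets with the composition of [nu_kernel] and
    [graph_kernel], whose integrals are iterated; the inner one is a change of variables. *)
Lemma ge0_integral_pair_law (F : E * E -> \bar R) :
  measurable_fun setT F -> (forall z, 0 <= F z)%E ->
  (\int[pi2]_z F z = \int[nu]_x \int[K x]_y F (x, y))%E.
Proof.
move=> mF F0.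
rewrite (eq_measure_integral (kcomp nu_kernel (graph_kernel K) tt)); last first.
  move=> A mA _; apply: eq_integral => x _.
  by rewrite xsectionE.
rewrite integral_kcomp//; apply: eq_integral => x _.
by rewrite ge0_integral_pushforward//.
Qed.

(* Version of E(F | X1), with default values where F(x, .) is not integrable. *)
Definition cond_fst (F : E * E -> R) : E -> R :=
  fun x => \int[K x]_y F (x, y).

Lemma ge0_measurable_kernel_integral (F : E * E -> \bar R) :
  measurable_fun setT F -> (forall z, 0 <= F z)%E ->
  measurable_fun setT (fun x => \int[K x]_y F (x, y))%E.
Proof. by move=> mF F0; exact: (measurable_kfcomp K). Qed.

(** The parts are taken on the product, before sectioning, so that the nonnegative case applies to
    each. *)
Lemma kernel_integralE (F : E * E -> \bar R) x :
  (\int[K x]_y F (x, y) =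
   \int[K x]_y F^\+ (x, y) - \int[K x]_y F^\- (x, y))%E.
Proof.
rewrite integralE; congr (_ - _)%E; apply: eq_integral => y _.
  by rewrite !funeposE.
by rewrite !funenegE.
Qed.

Lemma measurable_cond_fst F : measurable_fun setT F ->
  measurable_fun setT (cond_fst F).
Proof.
move=> /measurable_EFinP mF; apply: measurableT_comp => //.
under eq_fun do rewrite (kernel_integralE (EFin \o F)).
by apply: emeasurable_funB; apply: ge0_measurable_kernel_integral => //;
  [exact: measurable_funepos|exact: measurable_funeneg].
Qed.

Lemma integrable_kernel_integral (F : E * E -> \bar R) :
  (forall z, 0 <= F z)%E -> pi2.-integrable setT F ->
  nu.-integrable setT (fun x => \int[K x]_y F (x, y))%E.
Proof.
move=> F0 /integrableP[mF Foo]; apply/integrableP; split.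
  exact: ge0_measurable_kernel_integral.
move: Foo; under eq_integral do rewrite gee0_abs//.
rewrite ge0_integral_pair_law//; apply: le_lt_trans.
by under eq_integral do rewrite gee0_abs ?integral_ge0//.
Qed.

(** The section integrals of |F| are nu-integrable, hence finite nu-almost everywhere. *)
Lemma ae_integrable_pair (F : E * E -> \bar R) : pi2.-integrable setT F ->
  {ae nu, forall x, (K x).-integrable setT (fun y => F (x, y))}.
Proof.
move=> iF; have mF := measurable_int _ iF.
have := integrable_kernel_integral (fun z => abse_ge0 (F z)) (integrable_abse iF).
move=> /(integrable_ae measurableT); apply: filterS => x /(_ I) fx.
apply/integrableP; split; first exact: measurableT_comp mF _.
by rewrite ltey_eq fx.
Qed.

Lemma Rintegral_pair_law (F : E * E -> R) :
  pi2.-integrable setT (EFin \o F) ->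
  \int[pi2]_z F z = \int[nu]_x cond_fst F x.
Proof.
move=> iF; have mF := measurable_int _ iF; congr fine.
rewrite integralE.
rewrite !ge0_integral_pair_law//;
  [|exact: measurable_funeneg|exact: measurable_funepos].
rewrite -integralB//; [|apply: integrable_kernel_integral => //..]; last 2 first.
- exact: integrable_funepos.
- exact: integrable_funeneg.
apply: ae_eq_integral => //.
- by apply: emeasurable_funB; apply: ge0_measurable_kernel_integral => //;
    [exact: measurable_funepos|exact: measurable_funeneg].
- by apply/measurable_EFinP/measurable_cond_fst/measurable_EFinP.
(* [cond_fst] applies [fine] to the section integral, so the integrands are matched only at the x
   whose section is integrable. *)
apply: filterS (ae_integrable_pair iF) => x iFx _ /=.
by rewrite -kernel_integralE /cond_fst /Rintegral fineK// integrable_fin_num.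
Qed.

Lemma Lfun2_fst (u : E -> R) : u \in Lfun nu 2%:E -> u \o fst \in Lfun pi2 2%:E.
Proof.
move=> /Lfun2P[mu u2]; apply/Lfun2P; split; first exact: measurableT_comp.
rewrite ge0_integral_pair_law//=; last 2 first.
- by apply/measurable_EFinP; apply: measurable_funX; exact: measurableT_comp.
- by move=> z; rewrite lee_fin sqr_ge0.
under eq_integral do rewrite integral_cst// prob_kernel mule1.
exact: u2.
Qed.

(** Jensen under each probability [K x], then integration over nu. *)
Lemma Lfun2_cond_fst (F : E * E -> R) : F \in Lfun pi2 2%:E ->
  cond_fst F \in Lfun nu 2%:E.
Proof.
move=> /[dup] LF /Lfun2P[mF F2]; apply/Lfun2P.
have mc := measurable_cond_fst mF; split=> //.
have mF2 : measurable_fun setT (fun z => (F z ^+ 2)%:E).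
  by apply/measurable_EFinP; exact: measurable_funX.
have F20 z : (0 <= (F z ^+ 2)%:E)%E by rewrite lee_fin sqr_ge0.
move: F2; rewrite ge0_integral_pair_law//; apply: le_lt_trans.
apply: ge0_le_integral => //.
- by move=> x _; rewrite lee_fin sqr_ge0.
- by apply/measurable_EFinP; exact: measurable_funX.
- exact: (ge0_measurable_kernel_integral mF2).
(* Where the second moment of the section is infinite the bound is trivial, so it holds at every
   x. *)
move=> x _; have [Foo|] := ltP (\int[K x]_y (F (x, y) ^+ 2)%:E)%E +oo%E;
  last first.
  by rewrite leye_eq => /eqP ->; rewrite leey.
have LFx : (fun y => F (x, y)) \in Lfun (K x) 2%:E.
  by apply/Lfun2P; split=> //; exact: measurableT_comp mF _.
rewrite -[leRHS]fineK; last by rewrite ge0_fin_numE// integral_ge0.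
by rewrite lee_fin sqr_Rintegral_le// prob_kernel.
Qed.

(** The defining property of conditional expectation: u(x) is constant in y and leaves the inner
    integral wherever the section of F is integrable. *)
Lemma L2_inner_cond_fst (F : E * E -> R) (u : E -> R) :
  F \in Lfun pi2 2%:E -> u \in Lfun nu 2%:E ->
  L2_inner pi2 F (u \o fst) = L2_inner nu (cond_fst F) u.
Proof.
move=> LF Lu; have Lu1 := Lfun2_fst Lu.
rewrite /L2_inner Rintegral_pair_law; last exact: Lfun2_integrableM.
have pi2T : pi2 setT = 1%E by exact: probability_setT.
congr fine; apply: ae_eq_integral => //.
- apply/measurable_EFinP/measurable_cond_fst; apply: measurable_funM.
    exact: Lfun2_measurable LF.
  exact: Lfun2_measurable Lu1.
- apply/measurable_EFinP/measurable_funM; last exact: Lfun2_measurable Lu.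
  exact: (measurable_cond_fst (Lfun2_measurable LF)).
apply: filterS (ae_integrable_pair (Lfun2_integrable pi2T LF)) => x iFx _.
by rewrite /cond_fst /= RintegralZr.
Qed.

Lemma L2_inner_fst (u v : E -> R) : u \in Lfun nu 2%:E -> v \in Lfun nu 2%:E ->
  L2_inner pi2 (u \o fst) (v \o fst) = L2_inner nu u v.
Proof.
move=> Lu Lv; rewrite L2_inner_cond_fst//; last exact: Lfun2_fst.
apply: eq_Rintegral => x _; congr (_ * _).
by rewrite /cond_fst/= Rintegral_cst// prob_kernel mulr1.
Qed.

(** * Reversibility and the symmetry of the pair law *)

Hypothesis Ksa : self_adjoint_kernel nu K.

Let pi2T : pi2 setT = 1%E. Proof. exact: probability_setT. Qed.

Let nuT : nu setT = 1%E. Proof. exact: probability_setT. Qed.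

(** The mass of a rectangle C x D is the inner product of K 1_D with 1_C, so this is
    self-adjointness tested on indicators. *)
Lemma pair_law_setX A B : measurable A -> measurable B ->
  pi2 (A `*` B) = pi2 (B `*` A).
Proof.
have LI C : measurable C -> (\1_C : E -> R) \in Lfun nu 2%:E.
  by move=> mC; exact: (Lfun2_indic nuT).
have pE C D : measurable C -> measurable D ->
    pi2 (C `*` D) = (L2_inner nu (kernel_op K \1_D) \1_C)%:E.
  move=> mC mD.
  rewrite -(L2_inner_cond_fst (F := \1_D \o snd) _ (LI C mC)); last first.
    rewrite (_ : \1_D \o snd = \1_(setT `*` D)); last first.
      by apply/funext => z; rewrite /= !indicE in_setX in_setT.
    by apply: (Lfun2_indic pi2T); exact: measurableX.
  have mCD : measurable (C `*` D) by exact: measurableX.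
  rewrite /L2_inner (eq_Rintegral pi2 (g := \1_(C `*` D))); last first.
    by move=> z _; rewrite /= !indicE in_setX -natrM mulnb andbC.
  rewrite /Rintegral integral_indic// setIT fineK//.
  by rewrite fin_num_measure.
move=> mA mB; by rewrite !pE// Ksa ?LI// L2_innerC.
Qed.

(** Rectangles are stable under intersection and generate the product sigma-algebra, so agreement on
    them determines a finite measure. *)
Lemma pair_law_swap A : measurable A -> pi2 (@swap_pair E E @^-1` A) = pi2 A.
Proof.
move=> mA.
apply: (measure_unique
  [set A `*` B | A in @measurable _ E & B in @measurable _ E] (fun=> setT)
  _ _ _ _
  (measure_function_pushforward__canonical__measure_function_Measure
    pi2 (@measurable_swap _ _ E E)) pi2) => //.
- exact: measurable_prod_measurableType.
- move=> _ _ [A1 mA1 [B1 mB1 <-]] [A2 mA2 [B2 mB2 <-]].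
  exists (A1 `&` A2); first exact: measurableI.
  by exists (B1 `&` B2); [exact: measurableI|rewrite setXI].
- by move=> _; exists setT => //; exists setT => //; rewrite setXTT.
- by rewrite bigcup_const//; exists 0%N.
- move=> _ [B mB [C mC <-]]; rewrite [RHS]pair_law_setX//.
  by congr (pi2 _); apply/seteqP; split=> -[x y] [].
- by move=> _; apply: le_lt_trans (ltry 1); rewrite -pi2T.
Qed.

Lemma ge0_integral_swap (F : E * E -> \bar R) : measurable_fun setT F ->
  (forall z, 0 <= F z)%E ->
  (\int[pi2]_z F (swap_pair z) = \int[pi2]_z F z)%E.
Proof.
move=> mF F0; have F0' : {in setT, forall z, (0 <= F z)%E} by [].
have <- := ge0_integral_pushforward
  (@measurable_swap _ _ E E) pi2 measurableT mF F0'.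
apply: eq_measure_integral; first exact: measurable_swap.
by move=> mswap A mA _; exact: pair_law_swap.
Qed.

Lemma Rintegral_swap (F : E * E -> R) : measurable_fun setT F ->
  \int[pi2]_z F (swap_pair z) = \int[pi2]_z F z.
Proof.
move=> /measurable_EFinP mF; congr fine; rewrite integralE [RHS]integralE.
rewrite -(ge0_integral_swap (F := (EFin \o F)^\+)%E)//;
  last exact: measurable_funepos.
rewrite -(ge0_integral_swap (F := (EFin \o F)^\-)%E)//;
  last exact: measurable_funeneg.
congr (_ - _)%E; apply: eq_integral => z _; first by rewrite !funeposE.
by rewrite !funenegE.
Qed.

Lemma Lfun2_swap (F : E * E -> R) :
  F \in Lfun pi2 2%:E -> F \o swap_pair \in Lfun pi2 2%:E.
Proof.
move=> /Lfun2P[mF F2]; apply/Lfun2P; split.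
  by apply: measurableT_comp => //; exact: measurable_swap.
rewrite (ge0_integral_swap (F := fun z => (F z ^+ 2)%:E))// => [|z].
  by apply/measurable_EFinP; exact: measurable_funX.
by rewrite lee_fin sqr_ge0.
Qed.

Lemma L2_inner_swap (F G : E * E -> R) :
  F \in Lfun pi2 2%:E -> G \in Lfun pi2 2%:E ->
  L2_inner pi2 (F \o swap_pair) (G \o swap_pair) = L2_inner pi2 F G.
Proof.
move=> LF LG; rewrite -[RHS]Rintegral_swap//.
by apply: measurable_funM; [exact: Lfun2_measurable LF|exact: Lfun2_measurable LG].
Qed.

(** * The second coordinate and the operator K *)

Lemma Lfun2_snd (u : E -> R) : u \in Lfun nu 2%:E -> u \o snd \in Lfun pi2 2%:E.
Proof. by move=> Lu; exact: (Lfun2_swap (Lfun2_fst Lu)). Qed.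

(** [kernel_op K h] is convertible to [cond_fst K (h \o snd)], so facts about conditioning pass to
    K. *)
Lemma Lfun2_kernel_op (h : E -> R) : h \in Lfun nu 2%:E ->
  kernel_op K h \in Lfun nu 2%:E.
Proof. by move=> Lh; exact: (Lfun2_cond_fst (Lfun2_snd Lh)). Qed.

(** By symmetry of the pair law, E(F | X2) is obtained by swapping the coordinates of F and
    conditioning on the first. *)
Lemma L2_inner_snd (F : E * E -> R) (v : E -> R) :
  F \in Lfun pi2 2%:E -> v \in Lfun nu 2%:E ->
  L2_inner pi2 F (v \o snd) = L2_inner nu (cond_fst (F \o swap_pair)) v.
Proof.
move=> LF Lv; rewrite -L2_inner_cond_fst//; last exact: Lfun2_swap.
by rewrite -[LHS]L2_inner_swap//; exact: Lfun2_snd.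
Qed.

Lemma L2_inner_snd_fst (b u : E -> R) :
  b \in Lfun nu 2%:E -> u \in Lfun nu 2%:E ->
  L2_inner pi2 (b \o snd) (u \o fst) = L2_inner nu (kernel_op K b) u.
Proof. by move=> Lb Lu; rewrite L2_inner_cond_fst//; exact: Lfun2_snd. Qed.

Lemma L2_inner_fst_snd (a v : E -> R) :
  a \in Lfun nu 2%:E -> v \in Lfun nu 2%:E ->
  L2_inner pi2 (a \o fst) (v \o snd) = L2_inner nu (kernel_op K a) v.
Proof. by move=> La Lv; rewrite L2_inner_snd//; exact: Lfun2_fst. Qed.

Lemma L2_inner_snd_snd (b v : E -> R) :
  b \in Lfun nu 2%:E -> v \in Lfun nu 2%:E ->
  L2_inner pi2 (b \o snd) (v \o snd) = L2_inner nu b v.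
Proof.
move=> Lb Lv; rewrite -L2_inner_fst// -[RHS]L2_inner_swap//; exact: Lfun2_fst.
Qed.

Lemma L20_cond_fst F : L20 pi2 F -> L20 nu (cond_fst F).
Proof.
move=> [LF F0]; split; first exact: Lfun2_cond_fst.
by rewrite -Rintegral_pair_law//; exact: (Lfun2_integrable pi2T).
Qed.

Lemma L20_swap F : L20 pi2 F -> L20 pi2 (F \o swap_pair).
Proof.
move=> [LF F0]; split; first exact: Lfun2_swap.
by rewrite Rintegral_swap//; exact: Lfun2_measurable LF.
Qed.

Lemma L20_fst u : L20 nu u -> L20 pi2 (u \o fst).
Proof.
move=> [Lu u0]; split; first exact: Lfun2_fst.
rewrite Rintegral_pair_law; last exact: (Lfun2_integrable pi2T (Lfun2_fst Lu)).
rewrite -[RHS]u0; apply: eq_Rintegral => x _.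
by rewrite /cond_fst/= Rintegral_cst// prob_kernel mulr1.
Qed.

Lemma L20_snd u : L20 nu u -> L20 pi2 (u \o snd).
Proof. by move=> Lu; exact: (L20_swap (L20_fst Lu)). Qed.

Lemma L20_kernel_op h : L20 nu h -> L20 nu (kernel_op K h).
Proof. by move=> Lh; exact: (L20_cond_fst (L20_snd Lh)). Qed.

(** Self-adjointness moves K onto the test function, so that h and k are compared under nu rather
    than under each [K x]. *)
Lemma kernel_op_ae (h k : E -> R) :
  h \in Lfun nu 2%:E -> k \in Lfun nu 2%:E ->
  h = k %[ae nu] -> kernel_op K h = kernel_op K k %[ae nu].
Proof.
move=> Lh Lk hk; apply: eq_ae_of_L2_inner => [||u Lu]; try exact: Lfun2_kernel_op.
by rewrite !Ksa//; apply: L2_inner_ae => //; exact: Lfun2_kernel_op.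
Qed.

(** Default values at non-integrable sections may break pointwise linearity; the identity is proved
    weakly, with K moved onto the test function. *)
Lemma kernel_opB (h k : E -> R) :
  h \in Lfun nu 2%:E -> k \in Lfun nu 2%:E ->
  kernel_op K (h \- k) = kernel_op K h \- kernel_op K k %[ae nu].
Proof.
move=> Lh Lk; have Lhk := Lfun2B Lh Lk.
apply: eq_ae_of_L2_inner => [||u Lu].
- exact: Lfun2_kernel_op.
- by apply: Lfun2B; exact: Lfun2_kernel_op.
- rewrite L2_innerBl ?Lfun2_kernel_op// !Ksa//.
  by rewrite L2_innerBl ?Lfun2_kernel_op.
Qed.

(** Composition with a coordinate is isometric, so the difference has the same norm under nu and
    under the pair law. *)
Lemma ae_eq_fst (a a' : E -> R) :
  a \in Lfun nu 2%:E -> a' \in Lfun nu 2%:E ->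
  a = a' %[ae nu] -> a \o fst = a' \o fst %[ae pi2].
Proof.
move=> La La' /(eq_aeP La La') aa'; apply/eq_aeP; [exact: Lfun2_fst..|].
by rewrite -[RHS]aa'; apply: L2_inner_fst; exact: Lfun2B.
Qed.

Lemma ae_eq_snd (b b' : E -> R) :
  b \in Lfun nu 2%:E -> b' \in Lfun nu 2%:E ->
  b = b' %[ae nu] -> b \o snd = b' \o snd %[ae pi2].
Proof.
move=> Lb Lb' /(eq_aeP Lb Lb') bb'; apply/eq_aeP; [exact: Lfun2_snd..|].
by rewrite -[RHS]bb'; apply: L2_inner_snd_snd; exact: Lfun2B.
Qed.

(** * The residual f - a - b and the linear system for a and b *)

Section residual.
Context (f : E * E -> R) (a b : E -> R).
Hypotheses (Hf : H2 nu K f) (Ha : L20 nu a) (Hb : L20 nu b).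

Definition residual : E * E -> R := f \- (a \o fst) \- (b \o snd).

Let f1 := cond_fst f.
Let f2 := cond_fst (f \o swap_pair).

Let Lf : f \in Lfun pi2 2%:E := L20_Lfun Hf.
Let La : a \in Lfun nu 2%:E := L20_Lfun Ha.
Let Lb : b \in Lfun nu 2%:E := L20_Lfun Hb.
Let Lf1 : L20 nu f1 := L20_cond_fst Hf.
Let Lf2 : L20 nu f2 := L20_cond_fst (L20_swap Hf).

Lemma L20_residual : L20 pi2 residual.
Proof.
by apply: (L20B pi2T); [apply: (L20B pi2T) => //; exact: L20_fst|exact: L20_snd].
Qed.

(** With [residual_snd], computes both conditional expectations of the residual in weak form, term
    by term. *)
Lemma residual_fst u : u \in Lfun nu 2%:E ->
  L2_inner pi2 residual (u \o fst) = L2_inner nu (f1 \- a \- kernel_op K b) u.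
Proof.
move=> Lu; have Lu1 := Lfun2_fst Lu.
have L1 := Lfun2_fst La; have L2 := Lfun2_snd Lb.
have LKb := Lfun2_kernel_op Lb; have L1' := L20_Lfun Lf1.
rewrite /residual !L2_innerBl ?Lfun2B//.
by rewrite L2_inner_cond_fst// L2_inner_fst// L2_inner_snd_fst.
Qed.

Lemma residual_snd v : v \in Lfun nu 2%:E ->
  L2_inner pi2 residual (v \o snd) = L2_inner nu (f2 \- kernel_op K a \- b) v.
Proof.
move=> Lv; have Lv1 := Lfun2_snd Lv.
have L1 := Lfun2_fst La; have L2 := Lfun2_snd Lb.
have LKa := Lfun2_kernel_op La; have L2' := L20_Lfun Lf2.
rewrite /residual !L2_innerBl ?Lfun2B//.
by rewrite L2_inner_snd// L2_inner_fst_snd// L2_inner_snd_snd.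
Qed.

Lemma incremental_residualP : incremental_space nu K residual <->
  f1 \- a \- kernel_op K b = (fun=> 0) %[ae nu] /\
  f2 \- kernel_op K a \- b = (fun=> 0) %[ae nu].
Proof.
have L1 : L20 nu (f1 \- a \- kernel_op K b).
  exact: (L20B nuT (L20B nuT Lf1 Ha) (L20_kernel_op Hb)).
have L2 : L20 nu (f2 \- kernel_op K a \- b).
  exact: (L20B nuT (L20B nuT Lf2 (L20_kernel_op Ha)) Hb).
have L0 := L20_cst0 nuT.
split=> [[_ orth]|[e1 e2]].
  split; apply: L2_inner_eq0.
  - exact: L20_Lfun.
  - rewrite -residual_fst; last exact: L20_Lfun.
    (* The conditional expectation has mean zero, so it may serve as its own test function, with
       zero in the other coordinate. *)
    apply: orth; exists ((f1 \- a \- kernel_op K b) \o fst).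
      by exists (f1 \- a \- kernel_op K b).
    exists ((fun=> 0) \o snd); first by exists (fun=> 0).
    by apply/funext => z /=; rewrite addr0.
  - exact: L20_Lfun.
  - rewrite -residual_snd; last exact: L20_Lfun.
    apply: orth; exists ((fun=> 0) \o fst); first by exists (fun=> 0).
    exists ((f2 \- kernel_op K a \- b) \o snd).
      by exists (f2 \- kernel_op K a \- b).
    by apply/funext => z /=; rewrite add0r.
split; first exact: L20_residual.
move=> w [_ [u Hu <-] [_ [v Hv <-] <-]].
rewrite /L2_orthogonal L2_innerC L2_innerDl; last 3 first.
- exact: Lfun2_fst (L20_Lfun Hu).
- exact: Lfun2_snd (L20_Lfun Hv).
- exact: L20_Lfun L20_residual.
rewrite !(L2_innerC _ _ residual).
rewrite residual_fst ?residual_snd; [|exact: L20_Lfun..].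
rewrite (L2_inner_ae _ _ _ e1); [|exact: L20_Lfun..].
rewrite (L2_inner_ae _ _ _ e2); [|exact: L20_Lfun..].
by rewrite !L2_inner0l addr0.
Qed.

(** Elimination of b: applying K to the second equation gives K b = K f2 - K^2 a, and substitution
    in the first leaves an equation in a alone. *)
Lemma incremental_residual_kernelP : incremental_space nu K residual <->
  id_sub_kernel_sqr K a = f1 \- kernel_op K f2 %[ae nu] /\
  b = f2 \- kernel_op K a %[ae nu].
Proof.
have LKa := Lfun2_kernel_op La; have L2' := L20_Lfun Lf2.
have KB := kernel_opB L2' LKa.
rewrite incremental_residualP; split=> -[e1 e2].
  have e3 : b = f2 \- kernel_op K a %[ae nu].
    by apply: filterS e2 => x /= /(_ I) /eqP; rewrite subr_eq0 => /eqP.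
  split; last exact: e3.
  have e4 := kernel_op_ae Lb (Lfun2B L2' LKa) e3.
  apply: filterS3 e1 e4 KB => x /= /(_ I) e1 /(_ I) e4 /(_ I) KB _.
  by rewrite /id_sub_kernel_sqr /=; lra.
have e4 := kernel_op_ae Lb (Lfun2B L2' LKa) e2.
split; last by apply: filterS e2 => x /= /(_ I) -> _; rewrite subrr.
apply: filterS3 e1 e4 KB => x /= /(_ I) + /(_ I) e4 /(_ I) KB _.
by rewrite /id_sub_kernel_sqr /= => e1; lra.
Qed.

End residual.

End pair_law_theory.

(** * Existence, uniqueness and orthogonality of the decomposition *)

Unset Implicit Arguments.
Set Strict Implicit.

Theorem theorem3p4 (R : realType)
    (d0 : measure_display) (Omega : measurableType d0) (P : probability Omega R)
    (d : measure_display) (E : measurableType d)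
    (X : int -> {RV P >-> E}) (nu : probability E R) (K : R.-pker E ~> E)
    (chainX : stationary_reversible_markov_chain X nu K)
    (invK : L20_invertible nu (id_sub_kernel_sqr K))
    (f : E * E -> R) (Hf : H2 nu K f) :
  exists (a b : E -> R) (g : E * E -> R),
    [/\ incremental_decomposition nu K f a b g,
        forall (a' b' : E -> R) (g' : E * E -> R),
          incremental_decomposition nu K f a' b' g' ->
          [/\ a' = a %[ae nu], b' = b %[ae nu] & g' = g %[ae pair_law nu K]]
      & L2_orthogonal (pair_law nu K) g (fun z => a z.1 + b z.2)].
Proof.
have Ksa := chain_reversible chainX.
have nuT : nu setT = 1%E by exact: probability_setT.
have [S [[S0 Sae _ _] SA AS]] := invK.
pose f1 := cond_fst K f; pose f2 := cond_fst K (f \o swap_pair).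
have Lf1 : L20 nu f1 := L20_cond_fst Hf.
have Lf2 : L20 nu f2 := L20_cond_fst (L20_swap Ksa Hf).
have Lh : L20 nu (f1 \- kernel_op K f2).
  exact: (L20B nuT Lf1 (L20_kernel_op Ksa Lf2)).
(* The equation for b then holds pointwise by definition, and the one for a because S is a right
   inverse. *)
pose a := S (f1 \- kernel_op K f2); pose b := f2 \- kernel_op K a.
have La : L20 nu a := S0 _ Lh.
have LA c : L20 nu c -> L20 nu (id_sub_kernel_sqr K c).
  by move=> Lc; apply: (L20B nuT Lc); do 2!apply: (L20_kernel_op Ksa).
have Lb : L20 nu b := L20B nuT Lf2 (L20_kernel_op Ksa La).
have Ig : incremental_space nu K (residual f a b).
  by apply/(incremental_residual_kernelP Ksa Hf La Lb); split; [exact: AS|exact: aeW].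
exists a, b, (residual f a b); split.
- split=> //; apply: aeW => z _ /=.
  by rewrite /residual /=; lra.
- move=> a' b' g' [La' Lb' Ig' fE].
  (* A competitor g' is only almost everywhere a residual, so incrementality is first carried over
     to the residual of a' and b'. *)
  have g'E : g' = residual f a' b' %[ae pair_law nu K].
    by apply: filterS fE => z /= /(_ I) + _; rewrite /residual /= => ->; lra.
  have {Ig' } /(incremental_residual_kernelP Ksa Hf La' Lb')[Aa' b'E] :
      incremental_space nu K (residual f a' b').
    split; first exact: L20_residual.
    move=> w Ww; apply: eq_trans (Ig'.2 w Ww); apply: L2_inner_ae.
    - exact/L20_Lfun/L20_residual.
    - exact: L20_Lfun Ig'.1.
    - case: Ww => _ [u Lu <-] [_ [v Lv <-] <-].
      by apply: Lfun2D; [apply: Lfun2_fst|apply: Lfun2_snd => //]; exact: L20_Lfun.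
    - exact: ae_eq_sym.
  (* S respects classes and is a left inverse: a' = S((I - K^2) a') = S(f1 - K f2) = a. *)
  have aa' : a' = a %[ae nu].
    apply: ae_eq_trans (Sae _ _ (LA _ La') Lh Aa').
    apply: ae_eq_sym; exact: SA.
  have bb' : b' = b %[ae nu].
    have := kernel_op_ae Ksa (L20_Lfun La') (L20_Lfun La) aa'.
    by apply: filterS2 b'E => x /= /(_ I) b'E /(_ I) KE _; rewrite b'E /b /= KE.
  split=> //.
  have := ae_eq_snd Ksa (L20_Lfun Lb') (L20_Lfun Lb) bb'.
  have := ae_eq_fst K (L20_Lfun La') (L20_Lfun La) aa'.
  apply: filterS3 g'E => z /= /(_ I) -> /(_ I) ea /(_ I) eb _.
  by rewrite /residual /= ea eb.
- case: Ig => _; apply; exists (a \o fst); first by exists a.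
  by exists (b \o snd); first by exists b.
Qed.
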